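(* For every real $t$ with $0\le t\le 1$, \[ \mathrm{Li}_{3}(t)=\frac{8}{\pi}\int_{0}^{1}\frac{\left(\sin^{-1}(\sqrt{t}\,x)\right)^{2}\cos^{-1}x}{x}\,dx. \]
   Context: Here $\mathrm{Li}_{s}(t)=\sum_{n=1}^{\infty}\frac{t^{n}}{n^{s}}$ is the polylogarithm function, so $\mathrm{Li}_{3}(t)=\sum_{n=1}^{\infty}\frac{t^{n}}{n^{3}}$ is the trilogarithm. The symbols $\sin^{-1}$ and $\cos^{-1}$ denote the real inverse functions $\arcsin$ (values in $[-\pi/2,\pi/2]$) and $\arccos$ (values in $[0,\pi]$), not reciprocals. *)

(* Defs.v *)
From Stdlib Require Import Reals.
From Coquelicot Require Import Coquelicot.
Open Scope R_scope.

(* The summation index is shifted: the [n]-th term here is [t^(n+1) / (n+1)^s]. *)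
Definition polylog_term (s : nat) (t : R) (n : nat) : R :=
  t ^ S n / INR (S n) ^ s.

Definition polylog (s : nat) (t : R) : R := Series (polylog_term s t).

(* At [x = 0] the squared factor vanishes, so the value there is [0 * / 0 = 0],
   which is also the limit of the integrand: the integral is a proper one. *)
Definition trilog_integrand (t x : R) : R :=
  (asin (sqrt t * x)) ^ 2 * acos x / x.

(* Main.v *)
Require Import Defs.
From Stdlib Require Import Reals Lra Lia.
From Coquelicot Require Import Coquelicot.
Open Scope R_scope.

(** The expansion [asin y ^ 2 = 1/2 * sum_(n >= 1) (2 y) ^ (2 n) / (n ^ 2 * 'C(2 n, n))]
    is integrated term by term against [acos x / x], Wallis' integrals giving
    [PI / 8 * t ^ n / n ^ 3].  In the variable [s = asin y], the [n]-th remainder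
    vanishes to first order at [0] and has second derivative [c_n * sin s ^ (2 n)]
    with [c_n = 2 * 4 ^ n / 'C(2 n, n)], of order [sqrt n].  This makes it
    nonnegative and [O (c_n / n) * asin y], uniformly up to [y = 1], so the
    integrands converge uniformly on [[0, 1]], including for [t = 1]. *)

(** * Normalised central binomial coefficients and their size *)

(* 'C(2 n, n) / 4 ^ n *)
Fixpoint wallis (n : nat) : R :=
  match n with
  | O => 1
  | S m => wallis m * (2 * INR m + 1) / (2 * INR m + 2)
  end.

Lemma wallis_pos n : 0 < wallis n.
Proof.
induction n as [|n IH]; simpl; [lra|].
pose proof (pos_INR n).
apply Rdiv_lt_0_compat; [apply Rmult_lt_0_compat|]; lra.
Qed.

(** The right-hand side starts at 1 and grows with [n]: each step adds exactly
    [wallis n ^ 2 / (2 n + 2) ^ 2]. Hence [/ wallis n] is at most [sqrt (4 n + 1)]. *)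
Lemma wallis_lower_bound n : 1 <= wallis n ^ 2 * (4 * INR n + 1).
Proof.
induction n as [|n IH]; [simpl; lra|].
rewrite S_INR; cbn [wallis].
pose proof (pos_INR n) as Hn.
set (x := INR n) in *; set (w := wallis n) in *.
apply Rle_trans with (1 := IH).
replace ((w * (2 * x + 1) / (2 * x + 2)) ^ 2 * (4 * (x + 1) + 1))
  with (w ^ 2 * (4 * x + 1) + w ^ 2 / (2 * x + 2) ^ 2) by (field; lra).
assert (0 <= w ^ 2 / (2 * x + 2) ^ 2); [|lra].
apply Rdiv_le_0_compat; [apply pow2_ge_0|apply pow_lt; lra].
Qed.

(** The denominator is at least [sqrt n], by the lower bound on [wallis n] and
    [n * (4 n + 1) <= (2 n + 1) ^ 2]. *)
Lemma wallis_remainder_lim (K eps : R) : 0 <= K -> 0 < eps ->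
  eventually (fun n => K / (wallis n * (2 * INR n + 1)) < eps).
Proof.
intros HK Heps.
destruct (INR_unbounded ((K / eps) ^ 2)) as [N HN].
exists N; intros n Hn.
pose proof (wallis_pos n) as Hw; pose proof (wallis_lower_bound n) as Hb.
pose proof (pos_INR n) as Hn0; apply le_INR in Hn.
set (x := INR n) in *; set (w := wallis n) in *.
assert (HX : 0 < w * (2 * x + 1)) by (apply Rmult_lt_0_compat; lra).
assert (Hsq : x <= (w * (2 * x + 1)) ^ 2).
{ assert (w ^ 2 * (x * (4 * x + 1)) <= (w * (2 * x + 1)) ^ 2).
  { rewrite Rpow_mult_distr; apply Rmult_le_compat_l; [apply pow2_ge_0|nra]. }
  pose proof (Rmult_le_compat_r x _ _ Hn0 Hb); lra. }
assert (HKX : K / eps < w * (2 * x + 1)).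
{ apply Rnot_le_lt; intros Hle.
  assert ((w * (2 * x + 1)) ^ 2 <= (K / eps) ^ 2) by (apply pow_incr; lra).
  lra. }
apply Rlt_div_l; [lra|].
apply (proj1 (Rlt_div_l _ _ _ Heps)) in HKX; lra.
Qed.

(** * Wallis' integrals and the odd moments of [acos] *)

(** The antiderivative of [cos s ^ (2 n)] that vanishes at 0, given by the usual reduction
    formula. *)
Fixpoint cos_pow_primitive (n : nat) (s : R) : R :=
  match n with
  | O => s
  | S m => (sin s * cos s ^ S (2 * m) + (2 * INR m + 1) * cos_pow_primitive m s)
           / (2 * INR m + 2)
  end.

(* [auto_derive] leaves the factor [INR (S k)] of a power rule unfolded. *)
Ltac fold_INR_S := repeat match goal with
  |- context [match ?k with O => 1 | S _ => INR ?k + 1 end] =>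
    change (match k with O => 1 | S _ => INR k + 1 end) with (INR (S k)) end.

Lemma continuous_of_ex_derive (f : R -> R) (x : R) : ex_derive f x -> continuous f x.
Proof. apply (ex_derive_continuous (K := R_AbsRing) (V := R_NormedModule)). Qed.

Lemma INR_double n : INR (2 * n) = 2 * INR n.
Proof. rewrite mult_INR; simpl; ring. Qed.

Lemma sin_sq s : sin s ^ 2 = 1 - cos s ^ 2.
Proof. rewrite <- !Rsqr_pow2; pose proof (sin2_cos2 s); lra. Qed.

Lemma is_derive_cos_pow_primitive n s :
  is_derive (cos_pow_primitive n) s (cos s ^ (2 * n)).
Proof.
induction n as [|n IH].
{ apply (is_derive_id (K := R_AbsRing)). }
cbn [cos_pow_primitive].
pose proof (pos_INR n).
assert (Hd : ex_derive (cos_pow_primitive n) s) by (eexists; exact IH).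
evar_last.
{ auto_derive; [exact Hd|reflexivity]. }
rewrite (is_derive_unique (fun x : R => cos_pow_primitive n x) s _ IH).
change (n + (n + 0))%nat with (2 * n)%nat; fold_INR_S.
replace (2 * S n)%nat with (S (S (2 * n))) by lia.
rewrite S_INR, INR_double.
set (k := (2 * n)%nat).
replace (cos s ^ S (S k)) with (cos s ^ k * cos s ^ 2) by (simpl; ring).
pose proof (sin_sq s) as E.
transitivity ((cos s ^ k * (2 * INR n + 1) * (1 - sin s ^ 2) + cos s * cos s * cos s ^ k)
  / (2 * INR n + 2)).
{ field; lra. }
rewrite E; field; lra.
Qed.

Lemma cos_pow_primitive_0 n : cos_pow_primitive n 0 = 0.
Proof.
induction n as [|n IH]; [reflexivity|].
cbn [cos_pow_primitive]; rewrite IH, sin_0; unfold Rdiv; ring.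
Qed.

Lemma cos_pow_primitive_PI2 n :
  cos_pow_primitive n (PI / 2) = PI / 2 * wallis n.
Proof.
induction n as [|n IH]; cbn [cos_pow_primitive wallis]; [ring|].
pose proof (pos_INR n).
rewrite IH, cos_PI2, pow_i by lia; field; lra.
Qed.

(** Differentiability of [acos] fails at 1; the [atan] formula, valid at every positive argument,
    gives two-sided continuity there. *)
Lemma continuous_acos_nonneg x : 0 <= x -> continuous acos x.
Proof.
intros [Hx | <-].
- apply continuous_ext_loc with (fun y => atan (sqrt (1 - y²) / y)).
  { apply filter_imp with (fun y => 0 < y); [|now apply open_gt].
    intros y Hy; symmetry; now apply acos_atan. }
  apply continuous_atan_comp.
  apply (continuous_mult (K := R_AbsRing) (fun y => sqrt (1 - y²)) (fun y => / y)).
  + apply (continuous_comp (fun y : R => 1 - y²) sqrt); [|apply continuous_sqrt].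
    apply continuous_of_ex_derive.
    auto_derive; exact I.
  + apply continuous_of_ex_derive; auto_derive; lra.
- apply continuity_pt_filterlim, derivable_continuous_pt, derivable_pt_acos; lra.
Qed.

(** Integration by parts: the boundary term [s * cos s ^ (2 n + 2)] vanishes at both ends and
    Wallis' integral remains. *)
Lemma is_RInt_sin_mul_cos_pow n :
  is_RInt (fun s => s * sin s * cos s ^ S (2 * n)) 0 (PI / 2)
    (PI / 2 * wallis (S n) / (2 * INR n + 2)).
Proof.
pose proof (pos_INR n) as Hn.
evar_last.
{ apply is_RInt_derive with
    (f := fun s => (cos_pow_primitive (S n) s - s * cos s ^ (2 * S n)) / (2 * INR n + 2)).
  - intros s _.
    pose proof (is_derive_cos_pow_primitive (S n) s) as H.
    replace (2 * S n)%nat with (S (S (2 * n))) in * by lia.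
    revert H; generalize (cos_pow_primitive (S n)) as F; intros F H.
    assert (Hk := INR_double n); revert H Hk; generalize (2 * n)%nat as k; intros k H Hk.
    evar_last.
    { auto_derive; [eexists; exact H|reflexivity]. }
    rewrite (is_derive_unique (fun x : R => F x) s _ H).
    fold_INR_S; rewrite S_INR, Hk; simpl; field; lra.
  - intros s _; apply continuous_of_ex_derive; auto_derive; exact I. }
rewrite cos_pow_primitive_PI2, cos_pow_primitive_0, cos_PI2, pow_i by lia.
unfold minus, plus, opp; cbn -[wallis INR cos].
field; lra.
Qed.

(** The substitution [x = cos s] turns [acos x] into [s]. It reverses the orientation, which the
    sign of the derivative [- sin s] compensates. *)
Lemma is_RInt_pow_mul_acos n :
  is_RInt (fun x => x ^ S (2 * n) * acos x) 0 1
    (PI / 2 * wallis (S n) / (2 * INR n + 2)).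
Proof.
pose proof PI_RGT_0 as HPI.
assert (Hcont : forall x, 0 <= x -> continuous (fun x => x ^ S (2 * n) * acos x) x).
{ intros x Hx.
  apply (continuous_mult (K := R_AbsRing) (fun x => x ^ S (2 * n)) acos).
  - apply continuous_of_ex_derive.
    auto_derive; exact I.
  - now apply continuous_acos_nonneg. }
assert (Hcomp := is_RInt_comp (fun x => x ^ S (2 * n) * acos x) cos
  (fun s => - sin s) (PI / 2) 0).
rewrite cos_PI2, cos_0 in Hcomp.
rewrite Rmin_right, Rmax_left in Hcomp by lra.
specialize (Hcomp (fun s Hs => Hcont _ (cos_ge_0 s ltac:(lra) ltac:(lra)))).
assert (Hcos : forall s, 0 <= s <= PI / 2 ->
  is_derive cos s (- sin s) /\ continuous (fun s => - sin s) s).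
{ intros s _; split.
  - auto_derive; [exact I|ring].
  - apply continuous_of_ex_derive; auto_derive; exact I. }
specialize (Hcomp Hcos).
assert (Hval : is_RInt (fun s => s * sin s * cos s ^ S (2 * n)) 0 (PI / 2)
  (RInt (fun x => x ^ S (2 * n) * acos x) 0 1)).
{ evar_last.
  { apply is_RInt_swap, is_RInt_ext with
      (2 := is_RInt_opp _ _ _ _ Hcomp).
    intros s; rewrite Rmin_right, Rmax_left by lra; intros Hs.
    unfold scal, opp; cbn -[pow Nat.mul].
    unfold mult; cbn -[pow Nat.mul].
    rewrite acos_cos by lra; ring. }
  apply opp_opp. }
rewrite <- (is_RInt_unique _ _ _ _ (is_RInt_sin_mul_cos_pow n)).
rewrite (is_RInt_unique _ _ _ _ Hval).
apply (RInt_correct (V := R_CompleteNormedModule)), ex_RInt_continuous.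
intros x; rewrite Rmin_left by lra; intros [Hx _]; now apply Hcont.
Qed.

(** * Remainders of the expansion of the squared arcsine *)

(* The coefficient of [y ^ (2 n + 2)] in [asin y ^ 2]. *)
Definition asin_sq_coef (n : nat) : R := / (2 * (INR n + 1) ^ 2 * wallis (S n)).

Fixpoint asin_sq_rem (n : nat) (s : R) : R :=
  match n with
  | O => s ^ 2
  | S m => asin_sq_rem m s - asin_sq_coef m * sin s ^ (2 * S m)
  end.

Fixpoint asin_sq_rem' (n : nat) (s : R) : R :=
  match n with
  | O => 2 * s
  | S m => asin_sq_rem' m s
           - asin_sq_coef m * (2 * INR m + 2) * sin s ^ S (2 * m) * cos s
  end.

Lemma is_derive_asin_sq_rem n s :
  is_derive (asin_sq_rem n) s (asin_sq_rem' n s).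
Proof.
induction n as [|n IH]; cbn [asin_sq_rem asin_sq_rem'].
{ auto_derive; [exact I|ring]. }
apply (is_derive_minus (K := R_AbsRing) (V := R_NormedModule)); [exact IH|].
replace (2 * S n)%nat with (S (S (2 * n))) by lia.
auto_derive; [exact I|].
change (n + (n + 0))%nat with (2 * n)%nat; fold_INR_S.
rewrite S_INR, INR_double; simpl; ring.
Qed.

(** After [cos s ^ 2 = 1 - sin s ^ 2], the value of [asin_sq_coef n] is exactly the one that cancels
    the term in [sin s ^ (2 n)], so a single power survives. *)
Lemma is_derive_asin_sq_rem' n s :
  is_derive (asin_sq_rem' n) s (2 / wallis n * sin s ^ (2 * n)).
Proof.
induction n as [|n IH].
{ simpl; auto_derive; [exact I|field]. }
evar_last.
{ apply (is_derive_minus (K := R_AbsRing) (V := R_NormedModule) _ (fun s =>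
    asin_sq_coef n * (2 * INR n + 2) * sin s ^ S (2 * n) * cos s)); [exact IH|].
  auto_derive; [exact I|reflexivity]. }
change (n + (n + 0))%nat with (2 * n)%nat; fold_INR_S.
match goal with |- minus ?a ?b = _ => change (minus a b) with (a - b) end.
replace (2 * S n)%nat with (S (S (2 * n))) by lia.
rewrite S_INR, INR_double.
pose proof (pos_INR n); pose proof (wallis_pos n).
unfold asin_sq_coef; cbn [wallis].
set (k := (2 * n)%nat).
replace (sin s ^ S (S k)) with (sin s ^ k * sin s ^ 2) by (simpl; ring).
replace (sin s ^ S k * 1 * - sin s) with (- sin s ^ k * sin s ^ 2) by (simpl; ring).
set (p := sin s ^ k).
assert (E : sin s ^ 2 = 1 - cos s ^ 2) by apply sin_sq.
transitivity (2 / wallis n * p - (2 * INR n + 2) / (wallis n * (INR n + 1) * (2 * INR n + 1))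
   * ((2 * INR n + 1) * p * cos s ^ 2 - p * sin s ^ 2)).
{ field; lra. }
rewrite E; field; lra.
Qed.

Lemma asin_sq_rem_0 n : asin_sq_rem n 0 = 0.
Proof.
induction n as [|n IH]; cbn [asin_sq_rem]; [ring|].
rewrite IH, sin_0, pow_i by lia; ring.
Qed.

Lemma asin_sq_rem'_0 n : asin_sq_rem' n 0 = 0.
Proof.
induction n as [|n IH]; cbn [asin_sq_rem']; [ring|].
rewrite IH, sin_0, pow_i by lia; ring.
Qed.

(** * Two-sided bounds on the remainders *)

Lemma nonneg_of_derive_nonneg (f df : R -> R) (b : R) : 0 <= b -> f 0 = 0 ->
  (forall s, is_derive f s (df s)) -> (forall s, 0 <= s <= b -> 0 <= df s) ->
  0 <= f b.
Proof.
intros Hb H0 Hf Hdf.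
destruct (MVT_gen f 0 b df) as (c & Hc & E).
- intros; apply Hf.
- intros x _; apply continuity_pt_filterlim.
  apply continuous_of_ex_derive; eexists; apply Hf.
- rewrite Rmin_left, Rmax_right in Hc by lra.
  specialize (Hdf c Hc); nra.
Qed.

Lemma sin_pow_even_nonneg n s : 0 <= sin s ^ (2 * n).
Proof. rewrite pow_mult; apply pow_le, pow2_ge_0. Qed.

Lemma asin_sq_rem_nonneg n s : 0 <= s -> 0 <= asin_sq_rem n s.
Proof.
intros Hs.
apply (nonneg_of_derive_nonneg _ (asin_sq_rem' n)); auto using asin_sq_rem_0.
{ intros; apply is_derive_asin_sq_rem. }
intros r Hr.
apply (nonneg_of_derive_nonneg _ (fun s => 2 / wallis n * sin s ^ (2 * n)));
  [lra|apply asin_sq_rem'_0|intros; apply is_derive_asin_sq_rem'|].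
intros q _; apply Rmult_le_pos; [|apply sin_pow_even_nonneg].
apply Rdiv_le_0_compat; [lra|apply wallis_pos].
Qed.

(** From [z - z ^ 3 / 6 <= sin z] and [z ^ 2 <= 4], the latter because [PI <= 4]. *)
Lemma le_3_sin z : 0 <= z <= PI / 2 -> z <= 3 * sin z.
Proof.
intros Hz; pose proof PI_4.
destruct (pre_sin_bound z 0) as [Hb _]; [lra|lra|].
unfold sin_approx, sin_term in Hb; simpl in Hb.
assert (z * z * z <= 4 * z) by nra.
lra.
Qed.

(** The ratio [(th - s) / th] increases with [th], so its value at [PI / 2] bounds it; there
    [PI / 2 - s <= 3 * cos s]. Keeping the factor [th] is what later absorbs the division by [x]. *)
Lemma sub_le_mul_cos th s : 0 <= s <= th -> th <= PI / 2 -> th - s <= 3 * th * cos s.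
Proof.
intros Hs Hth; pose proof PI2_1.
pose proof (le_3_sin (PI / 2 - s) ltac:(lra)) as Hsin.
rewrite sin_shift in Hsin.
assert ((th - s) * (PI / 2) <= th * (PI / 2 - s)) by nra.
nra.
Qed.

(* This is [asin_sq_rem n th = RInt (fun s => (th - s) * asin_sq_rem'' n s) 0 th]
   together with [th - s <= 3 * th * cos s], which makes the integral elementary. *)
Lemma asin_sq_rem_le n th : 0 <= th <= PI / 2 ->
  asin_sq_rem n th <= 6 / (wallis n * (2 * INR n + 1)) * th.
Proof.
intros Hth.
pose proof (pos_INR n) as Hn; pose proof (wallis_pos n) as Hw.
set (c := 2 / wallis n).
assert (Hc : 0 <= c) by (apply Rdiv_le_0_compat; lra).
(* The bracket has derivative [(th - s)] times the second derivative of the remainder, its two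
   first-order terms cancelling; at [s = th] it reduces to the remainder itself. *)
pose (H := fun s => 3 * th * c / (2 * INR n + 1) * sin s ^ S (2 * n)
  - ((th - s) * asin_sq_rem' n s + asin_sq_rem n s)).
assert (HH : 0 <= H th).
{ apply (nonneg_of_derive_nonneg H
    (fun s => c * sin s ^ (2 * n) * (3 * th * cos s - (th - s)))); [lra| | |].
  - unfold H; rewrite sin_0, pow_i, asin_sq_rem_0, asin_sq_rem'_0 by lia; ring.
  - intros s; unfold H.
    pose proof (is_derive_asin_sq_rem n s) as H1.
    pose proof (is_derive_asin_sq_rem' n s) as H2.
    evar_last.
    { auto_derive; [repeat split; eexists; eassumption|reflexivity]. }
    rewrite (is_derive_unique (fun x : R => asin_sq_rem n x) s _ H1).
    rewrite (is_derive_unique (fun x : R => asin_sq_rem' n x) s _ H2).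
    change (n + (n + 0))%nat with (2 * n)%nat; fold_INR_S.
    rewrite S_INR, INR_double; fold c; field; lra.
  - intros s Hs; apply Rmult_le_pos.
    + apply Rmult_le_pos; [exact Hc|apply sin_pow_even_nonneg].
    + pose proof (sub_le_mul_cos th s); lra. }
unfold H in HH.
replace (6 / (wallis n * (2 * INR n + 1)) * th) with (3 * th * c / (2 * INR n + 1) * 1)
  by (unfold c; field; lra).
assert (Hk : 0 <= 3 * th * c / (2 * INR n + 1)) by (apply Rdiv_le_0_compat; nra).
assert (Hp : sin th ^ S (2 * n) <= 1).
{ rewrite <- (pow1 (S (2 * n))); apply pow_incr; split.
  - apply sin_ge_0; lra.
  - apply SIN_bound. }
pose proof (Rmult_le_compat_l _ _ _ Hk Hp); lra.
Qed.

(** * Uniform approximation of the integrand by partial sums *)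

(** The division by [x] is already carried out, hence the odd power. The sum has [n + 1] terms, so
    the matching remainder has index [S n]. *)
Definition trilog_partial (t : R) (n : nat) (x : R) : R :=
  sum_n (fun m => asin_sq_coef m * t ^ S m * (x ^ S (2 * m) * acos x)) n.

Lemma is_RInt_trilog_partial t n :
  is_RInt (trilog_partial t n) 0 1 (sum_n (fun m => PI / 8 * polylog_term 3 t m) n).
Proof.
assert (Hterm : forall m, is_RInt
  (fun x => asin_sq_coef m * t ^ S m * (x ^ S (2 * m) * acos x)) 0 1
  (PI / 8 * polylog_term 3 t m)).
{ intros m; evar_last.
  { apply (is_RInt_scal (V := R_NormedModule) _ _ _ (asin_sq_coef m * t ^ S m)).
    apply is_RInt_pow_mul_acos. }
  unfold scal; cbn -[asin_sq_coef pow wallis INR].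
  unfold mult, polylog_term, asin_sq_coef; cbn -[pow wallis INR].
  pose proof (pos_INR m); pose proof (wallis_pos (S m)).
  (* The factor [wallis (S m)] of the moment cancels the one in the coefficient. *)
  rewrite S_INR; field; lra. }
unfold trilog_partial; induction n as [|n IH].
- rewrite sum_O.
  apply is_RInt_ext with (2 := Hterm O); intros x _; now rewrite sum_O.
- rewrite sum_Sn.
  apply is_RInt_ext with (2 := is_RInt_plus _ _ _ _ _ _ IH (Hterm (S n))).
  intros x _; now rewrite sum_Sn.
Qed.

Lemma trilog_integrand_sub_partial t n x : 0 <= t <= 1 -> 0 <= x <= 1 ->
  trilog_integrand t x - trilog_partial t n x
  = asin_sq_rem (S n) (asin (sqrt t * x)) * acos x / x.
Proof.
intros Ht Hx.
destruct (Req_dec x 0) as [-> | Hx0].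
{ unfold trilog_integrand, trilog_partial, Rdiv; rewrite Rmult_0_r, asin_0, asin_sq_rem_0.
  rewrite (sum_n_ext _ (fun _ => 0)), sum_n_const; [ring|].
  intros m; rewrite pow_i by lia; apply Rmult_eq_0_compat_l, Rmult_0_l. }
assert (Hs : 0 <= sqrt t <= 1).
{ split; [apply sqrt_pos|rewrite <- sqrt_1; apply sqrt_le_1; lra]. }
assert (Hterm : forall m, asin_sq_coef m * t ^ S m * (x ^ S (2 * m) * acos x)
  = asin_sq_coef m * sin (asin (sqrt t * x)) ^ (2 * S m) * acos x / x).
{ intros m; rewrite sin_asin by nra.
  rewrite Rpow_mult_distr, pow_mult, pow2_sqrt by lra.
  replace (2 * S m)%nat with (S (S (2 * m))) by lia.
  simpl; field; exact Hx0. }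
unfold trilog_integrand, trilog_partial; induction n as [|n IH].
- rewrite sum_O, Hterm; cbn [asin_sq_rem]; field; exact Hx0.
- rewrite sum_Sn, Hterm.
  set (th := asin (sqrt t * x)) in *.
  change (asin_sq_rem (S (S n)) th) with
    (asin_sq_rem (S n) th - asin_sq_coef (S n) * sin th ^ (2 * S (S n))).
  match goal with |- _ - plus ?a ?b = _ => change (plus a b) with (a + b) end.
  replace ((asin_sq_rem (S n) th - asin_sq_coef (S n) * sin th ^ (2 * S (S n))) * acos x / x)
    with (asin_sq_rem (S n) th * acos x / x
          - asin_sq_coef (S n) * sin th ^ (2 * S (S n)) * acos x / x)
    by (field; exact Hx0).
  rewrite <- IH; ring.
Qed.

(** The constant is [6 * 3 * 4]: 6 from the remainder bound, 3 from [th <= 3 * sin th <= 3 * x],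
    which cancels the [x] in the denominator, and 4 from [acos x <= PI <= 4]. *)
Lemma trilog_partial_error t n x : 0 <= t <= 1 -> 0 <= x <= 1 ->
  Rabs (trilog_integrand t x - trilog_partial t n x)
  <= 72 / (wallis (S n) * (2 * INR (S n) + 1)).
Proof.
intros Ht Hx; rewrite trilog_integrand_sub_partial by assumption.
pose proof (pos_INR (S n)) as HN; pose proof (wallis_pos (S n)) as Hw.
set (e := wallis (S n) * (2 * INR (S n) + 1)).
assert (He : 0 < e) by (apply Rmult_lt_0_compat; lra).
destruct (Req_dec x 0) as [-> | Hx0].
{ rewrite Rmult_0_r, asin_0, asin_sq_rem_0; unfold Rdiv; rewrite !Rmult_0_l, Rabs_R0.
  apply Rdiv_le_0_compat; lra. }
assert (Hs : 0 <= sqrt t <= 1).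
{ split; [apply sqrt_pos|rewrite <- sqrt_1; apply sqrt_le_1; lra]. }
assert (Hy : 0 <= sqrt t * x <= x) by nra.
set (th := asin (sqrt t * x)).
assert (Hth : 0 <= th <= PI / 2).
{ pose proof (asin_bound (sqrt t * x)); fold th in H; split; [|lra].
  pose proof PI_RGT_0; apply sin_incr_0; try lra.
  unfold th; rewrite sin_0, sin_asin; lra. }
assert (Hthx : th <= 3 * x).
{ pose proof (le_3_sin th Hth) as H; unfold th in H at 2.
  rewrite sin_asin in H; lra. }
pose proof (asin_sq_rem_nonneg (S n) th (proj1 Hth)) as Hlo.
pose proof (asin_sq_rem_le (S n) th Hth) as Hup; fold e in Hup.
destruct (acos_bound x) as [Ha1 Ha2]; pose proof PI_4.
assert (H6 : 0 < 6 / e) by (apply Rdiv_lt_0_compat; lra).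
rewrite Rabs_pos_eq by (apply Rdiv_le_0_compat; [apply Rmult_le_pos|]; lra).
apply Rle_div_l; [lra|].
replace (72 / e * x) with (6 / e * (3 * x) * 4) by (field; lra).
apply Rmult_le_compat; try lra.
apply Rle_trans with (1 := Hup), Rmult_le_compat_l; lra.
Qed.

(** * Passage to the limit under the integral *)

(** Uniform convergence yields at once the convergence of the integrals, which are the partial sums
    of the series, and the integrability of the limit with the same value. *)
Lemma is_RInt_trilog_integrand t : 0 <= t <= 1 ->
  exists I, is_series (fun m => PI / 8 * polylog_term 3 t m) I
    /\ is_RInt (trilog_integrand t) 0 1 I.
Proof.
intros Ht.
(* [filterlim_RInt] asks for uniform convergence on all of [R]. *)
pose (f := fun n x => if Rle_dec 0 x then if Rle_dec x 1 then trilog_partial t n x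
  else trilog_integrand t x else trilog_integrand t x).
apply (filterlim_RInt (V := R_CompleteNormedModule) f 0 1 eventually).
{ apply eventually_filter. }
- intros n; apply is_RInt_ext with (2 := is_RInt_trilog_partial t n).
  intros x; rewrite Rmin_left, Rmax_right by lra; intros Hx; unfold f.
  destruct (Rle_dec 0 x); [|lra]; destruct (Rle_dec x 1); [reflexivity|lra].
- apply filterlim_locally; intros eps.
  destruct (wallis_remainder_lim 72 eps) as [N HN]; [lra|apply cond_pos|].
  exists N; intros n Hn x.
  assert (Hrefl : ball (trilog_integrand t x) eps (trilog_integrand t x)) by apply ball_center.
  unfold f; destruct (Rle_dec 0 x); [|exact Hrefl].
  destruct (Rle_dec x 1); [|exact Hrefl].
  apply ball_sym.
  apply Rle_lt_trans with (1 := trilog_partial_error t n x Ht (conj r r0)).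
  apply HN; lia.
Qed.

Theorem mainTheorem2 (t : R) (ht : 0 <= t <= 1) :
  ex_series (polylog_term 3 t) /\
  ex_RInt (trilog_integrand t) 0 1 /\
  polylog 3 t = 8 / PI * RInt (trilog_integrand t) 0 1.
Proof.
destruct (is_RInt_trilog_integrand t ht) as (I & Hser & Hint).
pose proof PI_RGT_0 as HPI.
assert (Hs : is_series (polylog_term 3 t) (8 / PI * I)).
{ apply is_series_ext with (fun m => 8 / PI * (PI / 8 * polylog_term 3 t m)).
  { intros m; apply Rminus_diag_uniq; field; lra. }
  now apply (is_series_scal (V := R_NormedModule) (8 / PI)). }
split; [now exists (8 / PI * I)|split; [now exists I|]].
rewrite (is_RInt_unique _ _ _ _ Hint).
now apply is_series_unique.
Qed.
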